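(* For every integer $n\ge 1$, there is a bijection between the set of isomorphism classes of unbalanced minimal set covers of an $n$-element set and the set of isomorphism classes of minimal set covers of a $t$-element set, where $t$ ranges over $0\le t\le n-1$.
   Context: A set cover of a finite set $V$ is a collection $\mathcal{C}$ of subsets of $V$ whose union is $V$; it is minimal if no member of $\mathcal{C}$ is contained in the union of the remaining members. A minimal set cover $\mathcal{C}$ of $V$ is unbalanced if it contains a set of cardinality $|V|-|\mathcal{C}|+1$, and balanced otherwise. Set covers are unlabeled: $(V,\mathcal{C})$ and $(V',\mathcal{C}')$ are identified if there is a bijection $V\to V'$ carrying the members of $\mathcal{C}$ exactly onto the members of $\mathcal{C}'$. (The empty collection is the minimal set cover of the empty set.) *)

(* Defs.v *)
From mathcomp Require Import all_boot.

Set Implicit Arguments.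
Unset Strict Implicit.
Unset Printing Implicit Defensive.

Section SetCovers.
Variable V : finType.
Implicit Type C : {set {set V}}.

Definition set_cover C : bool := cover C == [set: V].

Definition minimal_set_cover C : bool :=
  set_cover C && [forall A in C, ~~ (A \subset cover (C :\ A))].

(* #|A| = #|V| - #|C| + 1, written without the truncated subtraction of nat. *)
Definition unbalanced C : bool :=
  [exists A in C, #|A| + #|C| == #|V| + 1].

End SetCovers.

Definition set_cover_iso (V V' : finType)
    (C : {set {set V}}) (C' : {set {set V'}}) : bool :=
  [exists f : {ffun V -> V'},
    [&& injectiveb f, [forall y, y \in codom f]
      & [set f @: A | A : {set V} in C] == C']].

Definition minimal_cover_classes (V : finType) : {set {set {set {set V}}}} :=
  equivalence_partition (@set_cover_iso V V)
    [set C | minimal_set_cover C].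

Definition unbalanced_cover_classes (V : finType) : {set {set {set {set V}}}} :=
  equivalence_partition (@set_cover_iso V V)
    [set C | minimal_set_cover C && unbalanced C].

Lemma set_cover_isoP (V V' : finType)
    (C : {set {set V}}) (C' : {set {set V'}}) :
  reflect (exists2 f : V -> V', bijective f &
             [set f @: A | A : {set V} in C] = C')
          (set_cover_iso C C').
Proof.
apply: (iffP existsP) => [[f /and3P[/injectiveP fI /forallP fS /eqP fC]]|].
  exists f => //; exists (fun y => iinv (fS y)) => [x|y].
    by apply: fI; rewrite f_iinv.
  by rewrite f_iinv.
case=> f [g fK gK] fC; exists [ffun x => f x]; apply/and3P; split.
- by apply/injectiveP => x y; rewrite !ffunE; apply: (can_inj fK).
- by apply/forallP => y; apply/codomP; exists (g y); rewrite ffunE gK.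
- rewrite -fC; apply/eqP; apply: eq_imset => A.
  by apply: eq_imset => x; rewrite ffunE.
Qed.

Lemma set_cover_iso_refl (V : finType) (C : {set {set V}}) :
  set_cover_iso C C.
Proof.
apply/set_cover_isoP; exists id; first by exists id.
by rewrite (eq_imset (g := id)) ?imset_id // => A; rewrite imset_id.
Qed.

Lemma set_cover_iso_sym (V V' : finType)
    (C : {set {set V}}) (C' : {set {set V'}}) :
  set_cover_iso C C' -> set_cover_iso C' C.
Proof.
case/set_cover_isoP=> f [g fK gK] <-; apply/set_cover_isoP.
exists g; first by exists f.
rewrite -imset_comp (eq_imset (g := id)) ?imset_id // => A /=.
by rewrite -imset_comp (eq_imset (g := id)) ?imset_id.
Qed.

Lemma set_cover_iso_trans (V1 V2 V3 : finType) (C1 : {set {set V1}})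
    (C2 : {set {set V2}}) (C3 : {set {set V3}}) :
  set_cover_iso C1 C2 -> set_cover_iso C2 C3 -> set_cover_iso C1 C3.
Proof.
case/set_cover_isoP=> f fB <- /set_cover_isoP[g gB <-]; apply/set_cover_isoP.
exists (g \o f); first exact: bij_comp.
by rewrite -imset_comp; apply: eq_imset => A /=; rewrite imset_comp.
Qed.

(* Isomorphism classes over an arbitrary n-element set all have a
   representative on 'I_n. *)
Lemma set_cover_iso_ord (V : finType) (C : {set {set V}}) :
  exists C' : {set {set 'I_#|V|}}, set_cover_iso C C'.
Proof.
exists [set (@enum_rank V) @: A | A : {set V} in C].
by apply/set_cover_isoP; exists enum_rank => //; apply: enum_rank_bij.
Qed.

(* Main.v *)
Require Import Defs.
From mathcomp Require Import all_boot.
From mathcomp Require Import perm.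

Set Implicit Arguments.
Unset Strict Implicit.
Unset Printing Implicit Defensive.

(** If a member [A] makes a minimal cover [C] of [V] unbalanced, then [A] has
    exactly [#|C| - 1] points in its complement. Each of the other [#|C| - 1]
    members has a private point, which lies outside [A]; hence the complement
    of [A] consists of exactly one private point of each other member. So [C]
    is determined, up to a permutation of private points, by [C :\ A], which is
    a minimal cover of a proper subset of [V]; conversely a minimal cover of a
    proper subset is completed by the complement of a choice of one private
    point per member. Two choices of [A] in the same [C] are exchanged by a
    transposition that fixes all the other members. *)

(** * Images of families of sets under a map of points *)

Definition family_image (V W : finType) (f : V -> W) (C : {set {set V}}) :
    {set {set W}} :=
  [set f @: A | A : {set V} in C].

Section FamilyImage.
Variables V W : finType.
Implicit Types (f : V -> W) (C : {set {set V}}) (A : {set V}).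

Lemma family_image_inj f : injective f -> injective (family_image f).
Proof. by move=> fI; apply/imset_inj/imset_inj. Qed.

Lemma cover_family_image f C : cover (family_image f C) = f @: cover C.
Proof. by rewrite imset_cover cover_imset. Qed.

Lemma family_imageD1 f C A : injective f ->
  family_image f (C :\ A) = family_image f C :\ f @: A.
Proof.
move=> fI; apply/setP => B; rewrite in_setD1.
apply/imsetP/andP => [[A' /setD1P[neA A'C] ->]|[neB /imsetP[A' A'C defB]]].
  by split; [rewrite (inj_eq (imset_inj fI)) | apply: imset_f].
exists A' => //; rewrite in_setD1 A'C andbT.
by apply: contraNneq neB => <-; rewrite defB.
Qed.

Lemma card_family_image f C : injective f -> #|family_image f C| = #|C|.
Proof. by move=> fI; apply: card_imset; apply: imset_inj. Qed.

Lemma family_image_comp (U : finType) (g : U -> V) f (D : {set {set U}}) :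
  family_image (f \o g) D = family_image f (family_image g D).
Proof.
by rewrite /family_image -imset_comp; apply: eq_imset => A /=; rewrite imset_comp.
Qed.

Lemma family_image_eq f f' C : f =1 f' -> family_image f C = family_image f' C.
Proof. by move=> ff'; apply: eq_imset => A; apply: eq_imset. Qed.

End FamilyImage.

Lemma family_image_fixed (V : finType) (f : V -> V) (C : {set {set V}}) :
  {in C, forall A : {set V}, f @: A = A} -> family_image f C = C.
Proof.
by move=> fC; rewrite /family_image (eq_in_imset (g := id)) ?imset_id.
Qed.

Lemma set_cover_iso_perm (V : finType) (p : {perm V}) (C : {set {set V}}) :
  set_cover_iso C (family_image p C).
Proof.
by apply/set_cover_isoP; exists p => //; apply/injF_bij/perm_inj.
Qed.

(** * Private points and irredundant families *)

Definition star (V : finType) (C : {set {set V}}) (x : V) : {set {set V}} :=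
  [set A in C | x \in A].

(** Minimality split off from covering: when a member of a minimal cover is removed, the covering
    condition fails but this one survives. *)
Definition irredundant (V : finType) (C : {set {set V}}) : bool :=
  [forall A in C, ~~ (A \subset cover (C :\ A))].

Section Irredundant.
Variable V : finType.
Implicit Types (C E : {set {set V}}) (A B : {set V}) (x : V).

Lemma mem_star C x A : (A \in star C x) = (A \in C) && (x \in A).
Proof. by rewrite inE. Qed.

Lemma star_set1P C x A :
  reflect [/\ A \in C, x \in A & forall B, B \in C -> x \in B -> B = A]
          (star C x == [set A]).
Proof.
apply: (iffP eqP) => [sA|[inC xA uA]].
  have: A \in star C x by rewrite sA set11.
  rewrite mem_star => /andP[inC xA]; split=> // B BC xB.
  by apply/set1P; rewrite -sA mem_star BC.
apply/setP => B; rewrite mem_star in_set1.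
by apply/andP/eqP => [[] | ->] //; apply: uA.
Qed.

(** A point [x] with [star C x = [set A]] is a private point of [A]; minimality is used below in
    this form. *)
Lemma irredundantP C :
  reflect (forall A, A \in C -> exists x, star C x = [set A]) (irredundant C).
Proof.
apply: (iffP forall_inP) => irr A inC.
  have /subsetPn[x xA xC] := irr A inC; exists x; apply/eqP/star_set1P.
  split=> // B BC xB; apply: contraNeq xC => neBA.
  by apply/bigcupP; exists B => //; rewrite in_setD1 neBA.
have [x /eqP/star_set1P[_ xA uA]] := irr A inC.
apply/subsetPn; exists x => //; apply/bigcupP => -[B /setD1P[neBA BC] xB].
by case/eqP: neBA; apply: uA.
Qed.

(** A private point stays private when other members are dropped. *)
Lemma irredundantS C E : E \subset C -> irredundant C -> irredundant E.
Proof.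
move=> sEC /irredundantP irrC; apply/irredundantP => A AE.
have [x /eqP/star_set1P[_ xA uA]] := irrC A (subsetP sEC A AE).
by exists x; apply/eqP/star_set1P; split=> // B /(subsetP sEC); apply: uA.
Qed.

End Irredundant.

Lemma irredundant_image (V W : finType) (f : V -> W) (C : {set {set V}}) :
  injective f -> irredundant (family_image f C) = irredundant C.
Proof.
move=> fI; apply/forall_inP/forall_inP => irr A.
  move=> inC; have := irr (f @: A) (imset_f _ inC).
  rewrite -family_imageD1 // cover_family_image; apply: contra; exact: imsetS.
case/imsetP=> B BC ->; rewrite -family_imageD1 // cover_family_image.
apply: contra (irr B BC) => /subsetP sB; apply/subsetP => x xB.
by have := sB _ (imset_f f xB); rewrite mem_imset.
Qed.

Lemma set_cover_family_image (V W : finType) (f : V -> W) (C : {set {set V}}) :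
  bijective f -> set_cover (family_image f C) = set_cover C.
Proof.
move=> fB; have fI := bij_inj fB; rewrite /set_cover cover_family_image.
rewrite -(inj_eq (imset_inj fI)) /=; congr (_ == _).
apply/esym/setP => y; rewrite !inE; case: fB => g _ gK.
by apply/imsetP; exists (g y).
Qed.

Lemma minimal_set_cover_image (V W : finType) (f : V -> W) (C : {set {set V}}) :
  bijective f -> minimal_set_cover (family_image f C) = minimal_set_cover C.
Proof.
move=> fB; rewrite /minimal_set_cover set_cover_family_image //.
by congr (_ && _); apply: irredundant_image; apply: bij_inj.
Qed.

(** * Members of the extremal size that makes a cover unbalanced *)

Definition heavy (V : finType) (C : {set {set V}}) (A : {set V}) : bool :=
  (A \in C) && (#|A| + #|C| == #|V| + 1).

Lemma heavy_image (V W : finType) (f : V -> W) (C : {set {set V}}) A :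
  bijective f -> heavy C A -> heavy (family_image f C) (f @: A).
Proof.
move=> fB /andP[inC cA]; rewrite /heavy imset_f //= card_family_image; last first.
  exact: bij_inj.
by rewrite card_imset ?(eqP cA) ?(bij_eq_card fB) //; apply: bij_inj.
Qed.

Section Heavy.
Variable V : finType.
Implicit Types (C E : {set {set V}}) (A B : {set V}) (x : V).

Lemma card_heavyC C A : heavy C A -> #|~: A| = #|C :\ A|.
Proof.
case/andP=> inC /eqP; rewrite -(cardsC A) (cardsD1 A C) inC add1n addnS addn1.
by case=> /addnI.
Qed.

(** A pigeonhole count: the private points of the other members lie outside [A], so every singleton
    [[set B]] is the star of a point of [~: A]. There are as many such singletons as points of
    [~: A], hence each point realizes exactly one of them. *)
Lemma heavy_star C A : minimal_set_cover C -> heavy C A ->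
  star (C :\ A) @: (~: A) = [set [set B] | B in C :\ A]
  /\ {in ~: A &, injective (star (C :\ A))}.
Proof.
move=> /andP[_ /irredundantP irrC] hA; have inC : A \in C by case/andP: hA.
have sub : [set [set B] | B in C :\ A] \subset star (C :\ A) @: (~: A).
  apply/subsetP => _ /imsetP[B /setD1P[neBA BC] ->].
  have [x /eqP/star_set1P[_ xB uB]] := irrC B BC.
  apply/imsetP; exists x.
    (* A private point of [B] inside [A] would force [A = B]. *)
    by rewrite inE; apply: contra neBA => /(uB A inC)->.
  apply/esym/eqP/star_set1P; rewrite in_setD1 neBA BC; split=> // B'.
  by case/setD1P=> _; apply: uB.
have cE : #|[set [set B] | B in C :\ A]| = #|~: A|.
  by rewrite (card_heavyC hA) card_imset //; apply: set1_inj.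
have /eqP eqS : [set [set B] | B in C :\ A] == star (C :\ A) @: (~: A).
  by rewrite eqEcard sub cE leq_imset_card.
by split=> //; apply/imset_injP; rewrite -eqS cE.
Qed.

(** Every point of [B] outside [A] has star [[set B]] in [C :\ A], and stars are injective on
    [~: A], so there is only one such point. *)
Lemma heavyC_private C A B : minimal_set_cover C -> heavy C A ->
    B \in C :\ A ->
  exists x, [/\ B :\: A = [set x] & star C x = [set B]].
Proof.
move=> mC hA BE; have [im inj] := heavy_star mC hA.
have : [set B] \in star (C :\ A) @: (~: A) by rewrite im imset_f.
case/imsetP=> x xA defB; exists x.
have /esym/eqP/star_set1P[_ xB uB] := defB.
split; last first.
  apply/eqP/star_set1P; case/setD1P: (BE) => _ BC; split=> // B' B'C xB'.
  apply: uB => //; rewrite in_setD1 B'C andbT.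
  by apply: contraTneq xB' => ->; move: xA; rewrite inE.
apply/setP => y; rewrite !inE; apply/andP/eqP => [[yA yB]|->]; last first.
  by move: xA; rewrite inE.
apply: inj => //; rewrite ?inE // -defB.
have : star (C :\ A) y \in star (C :\ A) @: (~: A) by rewrite imset_f ?inE.
rewrite im => /imsetP[B' _ sy].
have : B \in star (C :\ A) y by rewrite mem_star BE.
by rewrite sy => /set1P->.
Qed.

Lemma tperm_imset a b A B : a \in A -> b \in B ->
  A :\: B = [set a] -> B :\: A = [set b] -> tperm a b @: A = B.
Proof.
move=> aA bB AB BA; apply/setP => x.
rewrite -{1}(tpermK a b x) mem_imset; last exact: perm_inj.
have bA : b \notin A by have := set11 b; rewrite -BA inE => /andP[].
have aB : a \notin B by have := set11 a; rewrite -AB inE => /andP[].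
case: tpermP => [->|->|/eqP xa /eqP xb].
- by rewrite (negPf bA) (negPf aB).
- by rewrite aA bB.
have /setP/(_ x) := AB; have /setP/(_ x) := BA.
by rewrite !inE (negPf xa) (negPf xb); case: (x \in A); case: (x \in B).
Qed.

Lemma heavy_unique C A A' : minimal_set_cover C -> heavy C A -> heavy C A' ->
  exists p : {perm V}, family_image p (C :\ A) = C :\ A'.
Proof.
move=> mC hA hA'; have [<-|neAA'] := eqVneq A A'.
  exists 1%g; apply: family_image_fixed => B _.
  by rewrite (eq_imset (g := id)) ?imset_id // => x; rewrite perm1.
have inC : A \in C by case/andP: hA.
have A'C : A' \in C by case/andP: hA'.
(* Each of [A] and [A'] is an ordinary member relative to the other, so they differ by one private
   point on each side. *)
have [b [A'A /eqP/star_set1P[_ bA' ub]]] : exists x,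
    [/\ A' :\: A = [set x] & star C x = [set A']].
  by apply: heavyC_private; rewrite // in_setD1 eq_sym neAA'.
have [a [AA' /eqP/star_set1P[_ aA ua]]] : exists x,
    [/\ A :\: A' = [set x] & star C x = [set A]].
  by apply: heavyC_private; rewrite // in_setD1 neAA'.
exists (tperm a b); rewrite family_imageD1 ?(tperm_imset aA bA') //; last first.
  exact: perm_inj.
have tA : tperm a b @: A = A' by apply: tperm_imset.
have tA' : tperm a b @: A' = A by rewrite tpermC; apply: tperm_imset.
(* A third member contains neither [a] nor [b], since these are private to [A] and [A']. *)
have tC B : B \in C -> B != A -> B != A' -> tperm a b @: B = B.
  move=> BC nA nA'; rewrite (eq_in_imset (g := id)) ?imset_id // => x xB.
  rewrite tpermD //.
    by apply: contra nA => /eqP xa; apply/eqP/ua; rewrite ?xa.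
  by apply: contra nA' => /eqP xb; apply/eqP/ub; rewrite ?xb.
congr (_ :\ _); apply/setP => B; apply/imsetP/idP => [[B' B'C ->]|BC].
  have [->|nA] := eqVneq B' A; first by rewrite tA.
  have [->|nA'] := eqVneq B' A'; first by rewrite tA'.
  by rewrite tC.
have [->|nA] := eqVneq B A; first by exists A'.
have [->|nA'] := eqVneq B A'; first by exists A.
by exists B; rewrite ?tC.
Qed.

(** The new member omits one chosen private point of each member of [E], which therefore stays
    private; a point left uncovered by [E] becomes private to the new member. *)
Lemma heavy_completion E : irredundant E -> cover E != [set: V] ->
  exists C A, [/\ minimal_set_cover C, heavy C A & C :\ A = E].
Proof.
move=> /irredundantP irrE; rewrite -subTset => /subsetPn[v _ vE].
(* [b] picks a private point for each member of [E]; outside [E] it takes the default value [v]. *)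
have /fin_all_exists[b bP] B : exists x, B \in E -> star E x = [set B].
  case: (boolP (B \in E)) => [/irrE[x sx]|_]; last by exists v.
  by exists x.
have bB B : B \in E -> b B \in B by move=> BE; case/eqP/star_set1P: (bP B BE).
set A := ~: (b @: E).
have vA : v \in A.
  rewrite inE; apply: contra vE => /imsetP[B BE ->].
  by apply/bigcupP; exists B; rewrite ?bB.
have AE : A \notin E.
  by apply: contra vE => AE; apply/bigcupP; exists A.
have bI : {in E &, injective b}.
  by move=> B B' BE B'E eqb; apply: set1_inj; rewrite -bP // eqb bP.
exists (A |: E), A; split; last exact: setU1K.
  apply/andP; split.
    rewrite /set_cover -subTset; apply/subsetP => x _; apply/bigcupP.
    have [xA|] := boolP (x \in A); first by exists A; rewrite ?setU11.
    rewrite inE negbK => /imsetP[B BE ->].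
    by exists B; rewrite ?bB // setU1r.
  apply/irredundantP => B /setU1P[->|BE].
    exists v; apply/eqP/star_set1P; rewrite setU11; split=> // B1.
    by case/setU1P=> // B1E vB; case/bigcupP: vE; exists B1.
  exists (b B); apply/eqP/star_set1P; have /eqP/star_set1P[_ _ uB] := bP B BE.
  rewrite setU1r ?bB //; split=> // B' /setU1P[->|]; last exact: uB.
  by rewrite inE imset_f.
(* Since [b] is injective on [E], the complement of [A] has [#|E|] points, while [A |: E] has
   [#|E| + 1] members. *)
rewrite /heavy setU11 cardsU1 AE addnCA addnC eqn_add2r.
by rewrite -(card_in_imset bI) -(cardsC (b @: E)) addnC eqxx.
Qed.

End Heavy.

(** * Permutations obtained by matching fibre sizes *)

Lemma card_fiber_in (V T : finType) (D : {set V}) (g : V -> T) (t : T) :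
  {in D &, injective g} -> #|[set x in D | g x == t]| = (t \in g @: D).
Proof.
move=> gI; case: imsetP => [[x xD ->]|nt].
  rewrite /= -(cards1 x); congr #|pred_of_set _|; apply/setP => y; rewrite !inE.
  by apply/andP/eqP => [[yD /eqP/gI->]|->].
apply/eqP; rewrite cards_eq0; apply/eqP/setP => x; rewrite !inE.
by apply/negP => /andP[xD /eqP gx]; case: nt; exists x.
Qed.

Section Ordinals.
Variable n : nat.
Implicit Types (C E : {set {set 'I_n}}) (A : {set 'I_n}).

(** Listed as tuples, the two colourings take each value equally often, so one list is a
    rearrangement of the other. *)
Lemma perm_of_card_fibers (T : eqType) (c c' : 'I_n -> T) :
    (forall t, #|[set x | c x == t]| = #|[set x | c' x == t]|) ->
  exists p : {perm 'I_n}, forall x, c' (p x) = c x.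
Proof.
move=> cc'.
have count_c (d : 'I_n -> T) t :
    count_mem t [tuple d i | i < n] = #|[set x | d x == t]|.
  by rewrite cardsE cardE size_filter count_map val_ord_tuple enumT.
have /tuple_permP[p eqp] : perm_eq [tuple c i | i < n] [tuple c' i | i < n].
  by apply/allP => t _ /=; rewrite !count_c cc'.
exists p => x.
have /(congr1 (fun s => tnth s x)) := val_inj eqp.
by rewrite !tnth_mktuple.
Qed.

(** Points are coloured by their preimage. For either injection, each colour [Some t] occurs once
    and [None] occurs [n - #|T|] times, so some permutation matches the colours. *)
Lemma perm_of_injections (T : finType) (g g' : T -> 'I_n) :
  injective g -> injective g' -> exists p : {perm 'I_n}, p \o g =1 g'.
Proof.
pose c (f : T -> 'I_n) x := [pick t | f t == x].
have cf f t : injective f -> c f (f t) = Some t.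
  by move=> fI; rewrite /c; case: pickP => [s /eqP/fI->|/(_ t)/eqP].
have card_c f o : injective f ->
    #|[set x | c f x == o]| = if o is Some _ then 1 else n - #|T|.
  move=> fI; case: o => [t|].
    rewrite -(cards1 (f t)); congr #|pred_of_set _|; apply/setP => x.
    rewrite !inE /c; case: pickP => [s /eqP<-|nx].
      by apply/eqP/eqP => [[->]|/fI->].
    by apply/esym/negP => /eqP xt; have := nx t; rewrite xt eqxx.
  rewrite cardsCs card_ord -(card_imset predT fI); congr (_ - _).
  apply: eq_card => x; rewrite !inE /c; case: pickP => [s /eqP<-|nx].
    by rewrite imset_f.
  by apply/esym/imsetP => -[t _ xt]; have := nx t; rewrite xt eqxx.
move=> gI g'I; have [|p cp] := @perm_of_card_fibers _ (c g) (c g').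
  by move=> o; rewrite !card_c.
exists p => t /=; have := cp (g t); rewrite (cf g) // {1}/c.
by case: pickP => // s /eqP <- [->].
Qed.

(* Points are matched according to the members of [E] containing them and to
   their membership in [A], resp. [A']; by [heavy_star] the class sizes agree. *)
Lemma heavy_complete_iso C C' A A' :
    minimal_set_cover C -> minimal_set_cover C' -> heavy C A -> heavy C' A' ->
    C :\ A = C' :\ A' ->
  set_cover_iso C C'.
Proof.
move=> mC mC' hA hA' eqE.
have [im inj] := heavy_star mC hA; have [im' inj'] := heavy_star mC' hA'.
rewrite -eqE in im' inj'; set E := C :\ A in eqE im inj im' inj'.
pose c (B : {set 'I_n}) x := (star E x, x \in B).
have cardF (B : {set 'I_n}) s : #|[set x | c B x == (s, false)]| =
    #|[set x in ~: B | star E x == s]|.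
  by apply: eq_card => x; rewrite !inE /c xpair_eqE andbC eqbF_neg.
have cardT (B : {set 'I_n}) s : #|[set x | c B x == (s, true)]| =
    #|[set x | star E x == s]| - #|[set x in ~: B | star E x == s]|.
  rewrite -(cardsID B [set x | star E x == s]).
  rewrite (_ : [set x in ~: B | star E x == s] = [set x | star E x == s] :\: B).
    by rewrite addnK; apply: eq_card => x; rewrite !inE /c xpair_eqE eqb_id.
  by apply/setP => x; rewrite !inE.
have [|p cp] := @perm_of_card_fibers _ (c A) (c A').
  by case=> s []; rewrite ?cardT ?cardF !card_fiber_in // im im'.
have inC : A \in C by case/andP: hA.
have A'C : A' \in C' by case/andP: hA'.
have pE : family_image p E = E.
  apply: family_image_fixed => B BE; apply/setP => y.
  rewrite -(permKV p y) mem_imset; last exact: perm_inj.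
  have [/setP/(_ B)] := cp (p^-1%g y).
  by rewrite !mem_star BE.
have pA : p @: A = A'.
  apply/setP => y; rewrite -(permKV p y) mem_imset; last exact: perm_inj.
  by have [_ ->] := cp (p^-1%g y).
have <- : family_image p C = C'.
  by rewrite -(setD1K inC) -/E /family_image imsetU1 -/(family_image p E) pE pA eqE
             setD1K.
exact: set_cover_iso_perm.
Qed.

End Ordinals.

(** * Covers embedded as families in a larger ground set *)

Lemma set_cover_iso_embedded (T T' V : finType) (g : T -> V) (g' : T' -> V)
    (D : {set {set T}}) (D' : {set {set T'}}) :
    injective g -> injective g' -> set_cover D -> set_cover D' ->
    family_image g D = family_image g' D' ->
  set_cover_iso D D'.
Proof.
move=> gI g'I /eqP cD /eqP cD' eqD.
(* As [D] and [D'] are covers, both images equal the union of the common family; hence [g] followed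
   by the inverse of [g'] is a bijection, called [f] below. *)
have imE : g @: setT = g' @: setT by rewrite -cD -cD' -!cover_family_image eqD.
have /fin_all_exists[f fP] s : exists t, g' t = g s.
  have : g s \in g' @: setT by rewrite -imE imset_f.
  by case/imsetP=> t _ ->; exists t.
have fI : injective f by move=> s t eqf; apply: gI; rewrite -!fP eqf.
apply/set_cover_isoP; exists f.
  apply: inj_card_bij => //.
  by rewrite -!cardsT -(card_imset _ gI) -(card_imset _ g'I) imE.
apply: (family_image_inj g'I); rewrite -eqD -/(family_image f D).
by rewrite -family_image_comp; apply: family_image_eq => s /=; rewrite fP.
Qed.

Lemma minimal_cover_restriction (V : finType) (E : {set {set V}}) :
    irredundant E ->
  exists (D : {set {set 'I_#|cover E|}}) (g : 'I_#|cover E| -> V),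
    [/\ minimal_set_cover D, injective g & family_image g D = E].
Proof.
move=> irrE; pose g : 'I_#|cover E| -> V := enum_val.
have gI : injective g by apply: enum_val_inj.
have img : g @: setT = cover E.
  apply/setP => x; apply/imsetP/idP => [[i _ ->]|xE]; first exact: enum_valP.
  by exists (enum_rank_in xE x); rewrite ?inE // /g enum_rankK_in.
(* Pulling back loses nothing, because every member of [E] lies in [cover E], the image of [g]. *)
pose D := [set g @^-1: B | B : {set V} in E].
have gD : family_image g D = E.
  rewrite /family_image /D -imset_comp (eq_in_imset (g := id)) ?imset_id //.
  move=> B BE /=; apply/setP => x; apply/imsetP/idP => [[i]|xB].
    by rewrite inE => ? ->.
  have : x \in g @: setT by rewrite img; apply/bigcupP; exists B.
  by case/imsetP=> i _ xi; exists i; rewrite // inE -xi.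
exists D, g; split=> //; apply/andP; split.
  by apply/eqP/(imset_inj gI); rewrite -cover_family_image gD img.
by rewrite -/(irredundant D) -(irredundant_image _ gI) gD.
Qed.

(** A relation rather than a function, since the heavy member and the embedding are choices; they
    are shown harmless only up to isomorphism. *)
Definition reduces_to (V T : finType) (C : {set {set V}}) (D : {set {set T}}) :=
  exists A (g : T -> V),
    [/\ heavy C A, injective g & family_image g D = C :\ A].

(** * Passing between unbalanced covers and covers of smaller sets *)

Section Reduction.
Variable n : nat.
Implicit Types C : {set {set 'I_n}}.

Lemma reduction_exists C : minimal_set_cover C -> unbalanced C ->
  exists (t : 'I_n) (D : {set {set 'I_t}}),
    minimal_set_cover D /\ reduces_to C D.
Proof.
move=> /andP[_ irrC] /exists_inP[A inC cA].
have irrE : irredundant (C :\ A) := irredundantS (subsetDl _ _) irrC.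
have ltE : #|cover (C :\ A)| < n.
  (* A private point of [A] is missed by the other members, which gives [t < n]. *)
  have := forall_inP irrC A inC => /subsetPn[x _ xE].
  rewrite -[n in _ < n]card_ord -cardsT proper_card // properT.
  by apply: contraNneq xE => ->; rewrite inE.
have [D [g [mD gI gD]]] := minimal_cover_restriction irrE.
exists (Ordinal ltE), D; split=> //.
by exists A, g; split=> //; rewrite /heavy inC.
Qed.

Lemma unreduction_exists (t : 'I_n) (D : {set {set 'I_t}}) :
  minimal_set_cover D ->
  exists C, [/\ minimal_set_cover C, unbalanced C & reduces_to C D].
Proof.
move=> /andP[cD irrD]; pose g := widen_ord (ltnW (ltn_ord t)).
have gI : injective g by move=> i j /(congr1 val) /= /val_inj.
have [||C [A [mC hA CA]]] := @heavy_completion _ (family_image g D).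
- by rewrite irredundant_image.
(* The point [t] of ['I_n] exceeds every index coming from ['I_t], so it is uncovered. *)
- rewrite cover_family_image (eqP cD); apply/eqP => /setP/(_ t).
  rewrite inE => /imsetP[i _ /(congr1 val) /= ti].
  by have := ltn_ord i; rewrite -ti ltnn.
exists C; split=> //; first by case/andP: hA => inC cA; apply/exists_inP; exists A.
by exists A, g; rewrite CA.
Qed.

(** The isomorphism [h] carries the heavy member of [C] to one of [C'], possibly not [A'];
    [heavy_unique] corrects this by a permutation, after which [D] and [D'] embed as the same
    family. *)
Lemma reduction_iso (T T' : finType) C C' (D : {set {set T}})
    (D' : {set {set T'}}) :
    minimal_set_cover C -> minimal_set_cover D -> minimal_set_cover D' ->
    set_cover_iso C C' -> reduces_to C D -> reduces_to C' D' ->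
  set_cover_iso D D'.
Proof.
move=> mC /andP[cD _] /andP[cD' _] /set_cover_isoP[h hB].
rewrite -/(family_image h C) => <- [A [g [hA gI gD]]] [A' [g' [hA' g'I gD']]].
have hI := bij_inj hB.
have [|p pE] := heavy_unique _ (heavy_image hB hA) hA'.
  by rewrite minimal_set_cover_image.
apply: (@set_cover_iso_embedded _ _ _ (p \o (h \o g)) g') => //.
  exact: inj_comp (@perm_inj _ _) (inj_comp hI gI).
rewrite (family_image_comp (h \o g) p) (family_image_comp g h) gD gD'.
by rewrite -pE family_imageD1.
Qed.

(** A permutation aligns the embeddings [g] and [g' \o f], so that the two covers agree away from
    their heavy members and [heavy_complete_iso] applies. *)
Lemma unreduction_iso (T : finType) C C' (D D' : {set {set T}}) :
    minimal_set_cover C -> minimal_set_cover C' ->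
    set_cover_iso D D' -> reduces_to C D -> reduces_to C' D' ->
  set_cover_iso C C'.
Proof.
move=> mC mC' /set_cover_isoP[f fB].
rewrite -/(family_image f D) => <- [A [g [hA gI gD]]] [A' [g' [hA' g'I gD']]].
have [p pg] := perm_of_injections gI (inj_comp g'I (bij_inj fB)).
have pB : bijective p by apply/injF_bij/perm_inj.
apply: set_cover_iso_trans (set_cover_iso_perm p C) _.
apply: (heavy_complete_iso _ mC' (heavy_image pB hA) hA').
  by rewrite minimal_set_cover_image.
rewrite -family_imageD1; last exact: perm_inj.
by rewrite -gD -gD' -!family_image_comp; apply: family_image_eq.
Qed.

End Reduction.

(** * Isomorphism classes and their representatives *)

Section Classes.
Variables (V : finType) (S : {set {set {set V}}}).
Let classes := equivalence_partition (@set_cover_iso V V) S.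

Lemma iso_class_exists C : C \in S -> exists2 K, K \in classes & C \in K.
Proof.
move=> CS; exists [set C' in S | set_cover_iso C C']; first exact: imset_f.
by rewrite inE CS set_cover_iso_refl.
Qed.

Lemma iso_class_mem K : K \in classes -> exists2 C, C \in K & C \in S.
Proof.
by case/imsetP=> C CS ->; exists C; rewrite // inE CS set_cover_iso_refl.
Qed.

Lemma iso_class_sub K C : K \in classes -> C \in K -> C \in S.
Proof. by case/imsetP=> C0 _ ->; rewrite inE => /andP[]. Qed.

Lemma iso_class_iso K C C' :
  K \in classes -> C \in K -> C' \in K -> set_cover_iso C C'.
Proof.
case/imsetP=> C0 _ ->; rewrite !inE => /andP[_ iC] /andP[_ iC'].
exact: set_cover_iso_trans (set_cover_iso_sym iC) iC'.
Qed.

Lemma iso_class_eq K K' C C' : K \in classes -> K' \in classes ->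
  C \in K -> C' \in K' -> set_cover_iso C C' -> K = K'.
Proof.
case/imsetP=> C0 _ -> /imsetP[C1 _ ->]; rewrite !inE.
move=> /andP[_ i0] /andP[_ i1] iC.
have i01 : set_cover_iso C0 C1.
  exact: set_cover_iso_trans (set_cover_iso_trans i0 iC) (set_cover_iso_sym i1).
apply/setP => B; rewrite !inE; congr (_ && _); apply/idP/idP => iB.
  exact: set_cover_iso_trans (set_cover_iso_sym i01) iB.
exact: set_cover_iso_trans i01 iB.
Qed.

End Classes.

(** This allows the correspondence of classes to be given through representatives, without choosing
    canonical ones. *)
Lemma bijection_of_relation (X Y : finType) (P : X -> Y -> Prop) :
    (forall x, exists y, P x y) -> (forall y, exists x, P x y) ->
    (forall x y y', P x y -> P x y' -> y = y') ->
    (forall x x' y, P x y -> P x' y -> x = x') ->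
  exists f : X -> Y, bijective f.
Proof.
move=> /fin_all_exists[f fP] /fin_all_exists[g gP] uY uX; exists f; exists g.
  by move=> x; apply: uX (gP _) (fP _).
by move=> y; apply: uY (fP _) (gP _).
Qed.

Lemma set_cover_iso_card (V V' : finType) (C : {set {set V}})
    (C' : {set {set V'}}) : set_cover_iso C C' -> #|V| = #|V'|.
Proof. by case/set_cover_isoP=> f /bij_eq_card. Qed.

Theorem theorem2p8 (n : nat) (hn : 1 <= n) :
  exists f : {K | K \in unbalanced_cover_classes 'I_n} ->
             {t : 'I_n & {K | K \in minimal_cover_classes 'I_t}},
    bijective f.
Proof.
apply: (@bijection_of_relation _ _ (fun
    (K : {K | K \in unbalanced_cover_classes 'I_n})
    (z : {t : 'I_n & {K | K \in minimal_cover_classes 'I_t}}) => exists C D,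
  [/\ C \in sval K, D \in sval (tagged z) & reduces_to C D])).
- case=> K KU /=; have [C CK] := iso_class_mem KU.
  rewrite inE => /andP[mC uC].
  have [t [D [mD rD]]] := reduction_exists mC uC.
  have [|L LM DL] := @iso_class_exists _ [set D | minimal_set_cover D] D.
    by rewrite inE.
  by exists (Tagged (fun t : 'I_n => {K | K \in minimal_cover_classes 'I_t})
    (exist _ L LM)), C, D.
- case=> t [L LM] /=; have [D DL] := iso_class_mem LM; rewrite inE => mD.
  have [C [mC uC rD]] := unreduction_exists mD.
  have [|K KU CK] := @iso_class_exists _
    [set C | minimal_set_cover C && unbalanced C] C; first by rewrite inE mC.
  by exists (exist _ K KU), C, D.
- case=> K KU [t [L LM]] [t' [L' LM']] /= [C [D [CK DL rD]]].
  case=> [C' [D' [CK' DL' rD']]].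
  have := iso_class_sub KU CK; rewrite inE => /andP[mC _].
  have := iso_class_sub LM DL; rewrite inE => mD.
  have := iso_class_sub LM' DL'; rewrite inE => mD'.
  have iD := reduction_iso mC mD mD' (iso_class_iso KU CK CK') rD rD'.
  (* Isomorphic covers have ground sets of equal size, so the indices agree; eliminating [tt'] then
     puts both classes over the same ground set. *)
  have tt' : t = t' by apply: val_inj;
    have := set_cover_iso_card iD; rewrite !card_ord.
  case: _ / tt' L' LM' D' DL' rD' mD' iD => L' LM' D' DL' rD' mD' iD.
  congr Tagged; apply: val_inj; exact: iso_class_eq LM LM' DL DL' iD.
- case=> K KU [K' KU'] [t [L LM]] /= [C [D [CK DL rD]]].
  case=> [C' [D' [CK' DL' rD']]]; apply: val_inj => /=.
  have := iso_class_sub KU CK; rewrite inE => /andP[mC _].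
  have := iso_class_sub KU' CK'; rewrite inE => /andP[mC' _].
  apply: iso_class_eq KU KU' CK CK' _.
  exact: unreduction_iso mC mC' (iso_class_iso LM DL DL') rD rD'.
Qed.
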